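(* Let $N\ge 2$, let $\Gamma$ be the incidence matrix of the interaction graph on the vertex set $S=\{1,\dots,N\}$ (with one directed edge $(i,j)$ for every pair $i<j$), and let $\mathcal{M}$ be the space of real $N\times N$ matrices $A$ with $A^{t}=-A$ and $A\mathbf{1}=0$. Then the map $\phi:\operatorname{Ker}(\Gamma)\to\mathcal{M}$ given by $\phi(C)=M$, where $$M_{i,j}=\begin{cases} C(\theta(i,j)) & \text{if } i<j,\\ -C(\theta(j,i)) & \text{if } i>j,\\ 0 & \text{if } i=j,\end{cases}$$ is a linear isomorphism. In particular, $\operatorname{Ker}(\Gamma)$ and $\mathcal{M}$ are isomorphic.
   Context: The interaction graph (all transition rates $q_{ij}$, $i\ne j$, being positive) is the digraph with vertex set $S=\{1,\dots,N\}$ and edge set $E=\{(i,j)\in S\times S: i<j\}$, so $|E|=\binom N2$. Edges are ordered lexicographically through the bijection $\theta:E\to\{1,\dots,\binom N2\}$, $\theta(i,j)=(i-1)\left(N-\frac i2\right)+j-i$. The incidence matrix $\Gamma$ is the real $N\times\binom N2$ matrix whose column number $\theta(i,j)$, for $i<j$, has $-1$ in row $i$, $1$ in row $j$ and $0$ in all other rows. $\operatorname{Ker}(\Gamma)=\{C\in\mathbb{R}^{\binom N2}:\Gamma C=0\}$, and $C(r)$ denotes the $r$-th coordinate of $C$. $\mathbf{1}=(1,\dots,1)^{t}\in\mathbb{R}^N$. *)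

(* Defs.v *)
From HB Require Import structures.
From mathcomp Require Import all_boot all_order all_algebra zify ring.
From mathcomp Require Import reals.

Set Implicit Arguments.
Unset Strict Implicit.
Unset Printing Implicit Defensive.

Import Order.TTheory GRing.Theory Num.Theory.
Local Open Scope ring_scope.

(* The vertex set {1, ..., N} is represented by 'I_N, the ordinal i standing
   for the vertex i.+1; likewise the edge numbers {1, ..., 'C(N, 2)} are
   represented by 'I_'C(N, 2), the ordinal r standing for the number r.+1. *)

Definition edge (N : nat) := {e : 'I_N * 'I_N | (e.1 < e.2)%N}.

Definition Edge (N : nat) (i j : 'I_N) (lt_ij : (i < j)%N) : edge N :=
  exist _ (i, j) lt_ij.

Definition source (N : nat) (e : edge N) : 'I_N := (val e).1.
Definition target (N : nat) (e : edge N) : 'I_N := (val e).2.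

(* (i - 1) (N - i / 2) + j - i, for 1-based i and j; i.-1 * (2 N - i) is always
   even, so the halving is exact (see edge_numberE). *)
Definition edge_number (N i j : nat) : nat :=
  ((i.-1 * (N.*2 - i))./2 + (j - i))%N.

Lemma edge_numberE (N i j : nat) : (0 < i)%N -> (i < j)%N -> (j <= N)%N ->
  (edge_number N i j)%:R
    = (i%:R - 1) * (N%:R - i%:R / 2) + j%:R - i%:R :> rat.
Proof.
move=> i_gt0 lt_ij le_jN; rewrite /edge_number natrD (natrB _ (ltnW lt_ij)).
have e : (i.-1 * (N.*2 - i) = (i.-1 * (N.*2 - i))./2.*2)%N.
  rewrite even_halfK // oddM oddB ?odd_double; last by lia.
  by case: i i_gt0 {lt_ij} => //= i _; case: (odd i).
have := congr1 (fun n => n%:R : rat) e.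
rewrite natrM natrB; last by lia.
rewrite -!muln2 !natrM -subn1 natrB //.
set x := (_./2)%:R => ex.
have -> : x = (i%:R - 1) * (N%:R * 2 - i%:R) / 2 by rewrite ex mulfK.
by field.
Qed.

Lemma edge_number_gt0 (N i j : nat) : (i < j)%N -> (0 < edge_number N i j)%N.
Proof. by move=> lt_ij; rewrite addn_gt0 subn_gt0 lt_ij orbT. Qed.

Lemma edge_number_step (N i : nat) : (i < N)%N ->
  edge_number N i.+2 i.+2 = edge_number N i.+1 N.
Proof.
move=> lt_iN; rewrite /edge_number subnn addn0 /=.
have -> : (i.+1 * (N.*2 - i.+2) = i * (N.*2 - i.+1) + (N - i.+1).*2)%N.
  by nia.
by rewrite halfD odd_double andbF doubleK.
Qed.

Lemma edge_number_base_mono (N i i' : nat) : (i <= i')%N -> (i' <= N)%N ->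
  (edge_number N i.+1 i.+1 <= edge_number N i'.+1 i'.+1)%N.
Proof.
move=> le_ii'; rewrite -(subnKC le_ii'); elim: (i' - i)%N => [|k IH] leN.
  by rewrite addn0.
apply: leq_trans (IH _) _; first by lia.
rewrite addnS edge_number_step; last by lia.
by rewrite /edge_number subnn leq_add2l.
Qed.

Lemma edge_number_le (N i j : nat) : (i < j)%N -> (j < N)%N ->
  (edge_number N i.+1 j.+1 <= 'C(N, 2))%N.
Proof.
move=> lt_ij lt_jN.
apply: (@leq_trans (edge_number N i.+1 N)).
  by rewrite /edge_number leq_add2l; lia.
rewrite -edge_number_step; last by lia.
apply: leq_trans (@edge_number_base_mono N i.+1 N.-1 _ _) _; try lia.
rewrite bin2 /edge_number subnn addn0 prednK; last by lia.
by apply: half_leq; rewrite /=; nia.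
Qed.

Lemma theta_proof (N : nat) (e : edge N) :
  ((edge_number N (source e).+1 (target e).+1).-1 < 'C(N, 2))%N.
Proof.
have lt_e := valP e.
have := @edge_number_le N _ _ lt_e (ltn_ord _).
have := @edge_number_gt0 N (source e).+1 (target e).+1 lt_e.
by rewrite /source /target; lia.
Qed.

Definition theta (N : nat) (e : edge N) : 'I_('C(N, 2)) :=
  Ordinal (theta_proof e).

Lemma theta_inj (N : nat) : injective (@theta N).
Proof.
suff lt_theta (e f : edge N) : (source e < source f)%N ->
    (theta e < theta f)%N.
  move=> e f eq_ef; have := lt_theta e f.
  have := lt_theta f e; rewrite eq_ef ltnn => a b.
  have eq_t : source e = source f :> nat.
    case: (ltngtP (source e) (source f)) => // h.
      by have := b h.
    by have := a h.
  have lt_e : (source e < target e)%N := valP e.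
  have lt_f : (source f < target f)%N := valP f.
  have eq_h : target e = target f :> nat.
    move: eq_ef => /(congr1 val) /= /(congr1 succn).
    rewrite !prednK ?edge_number_gt0 // eq_t => /addnI.
    by move: lt_e lt_f; rewrite eq_t; lia.
  apply: val_inj; move: eq_t eq_h; rewrite /source /target.
  by case: (val e) (val f) => [a1 a2] [b1 b2] /= /val_inj-> /val_inj->.
move=> lt_ef; have lt_e := valP e; have lt_f := valP f.
rewrite /= -/(source e) -/(target e) -/(source f) -/(target f) in lt_e lt_f *.
have gt0 := @edge_number_gt0 N (source e).+1 (target e).+1 lt_e.
have hf := ltn_ord (source f).
have he := ltn_ord (target e).
have m := @edge_number_base_mono N (source e).+1 (source f) lt_ef (ltnW hf).
rewrite edge_number_step // in m.
have l1 : (edge_number N (source e).+1 (target e).+1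
           <= edge_number N (source e).+1 N)%N.
  by rewrite leq_add2l leq_sub2r.
have l2 : (edge_number N (source f).+1 (source f).+1
           < edge_number N (source f).+1 (target f).+1)%N.
  by rewrite ltn_add2l subnn subn_gt0.
by lia.
Qed.

Lemma card_edge (N : nat) : #|{: edge N}| = 'C(N, 2).
Proof.
rewrite card_sig -sum1_card.
rewrite -(pair_big_dep xpredT (fun i j : 'I_N => (i < j)%N) (fun _ _ => 1%N)).
rewrite (exchange_big_dep xpredT) //= -bin2_sum big_mkord.
apply: eq_bigr => j _; rewrite sum1_card.
have widen_inj : injective (widen_ord (ltnW (ltn_ord j))).
  by move=> a b /(congr1 val) /= /val_inj.
rewrite -[RHS]card_ord -(card_imset _ widen_inj).
apply: eq_card => i; rewrite [LHS]/=; apply/idP/imsetP => [lt_ij | [k _ ->]].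
  by exists (Ordinal lt_ij) => //; apply: val_inj.
exact: (ltn_ord k).
Qed.

Lemma theta_onto (N : nat) (r : 'I_('C(N, 2))) : r \in codom (@theta N).
Proof.
by apply: inj_card_onto; [exact: theta_inj | rewrite card_ord card_edge].
Qed.

Definition theta_inv (N : nat) (r : 'I_('C(N, 2))) : edge N :=
  iinv (theta_onto r).

Lemma thetaK (N : nat) : cancel (@theta N) (@theta_inv N).
Proof. by move=> e; apply: theta_inj; rewrite f_iinv. Qed.

Lemma theta_invK (N : nat) : cancel (@theta_inv N) (@theta N).
Proof. by move=> r; rewrite f_iinv. Qed.

Definition incidence (R : realType) (N : nat) : 'M[R]_(N, 'C(N, 2)) :=
  \matrix_(k, r)
    if k == source (theta_inv r) then -1
    else if k == target (theta_inv r) then 1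
    else 0.

Lemma incidenceE (R : realType) (N : nat) (k : 'I_N) (e : edge N) :
  incidence R N k (theta e)
    = if k == source e then -1 else if k == target e then 1 else 0.
Proof. by rewrite mxE thetaK. Qed.

Definition Ker (R : realType) (m n : nat) (A : 'M[R]_(m, n)) :
    {vspace 'cV[R]_n} :=
  lker (linfun (mulmx A)).

Lemma mem_Ker (R : realType) (m n : nat) (A : 'M[R]_(m, n)) (C : 'cV[R]_n) :
  C \in Ker A <-> A *m C = 0.
Proof. by rewrite memv_ker lfunE /=; split=> /eqP. Qed.

Definition calM (R : realType) (N : nat) : {vspace 'M[R]_N} :=
  (lker (linfun (trmx \+ idfun))
     :&: lker (linfun (mulmxr (const_mx 1 : 'cV[R]_N))))%VS.

Lemma mem_calM (R : realType) (N : nat) (A : 'M[R]_N) :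
  A \in calM R N <-> A^T = - A /\ A *m const_mx 1 = 0 :> 'cV[R]_N.
Proof.
rewrite memv_cap !memv_ker !lfunE /= addr_eq0.
by split=> [/andP[/eqP ? /eqP ?] | [-> ->]]; rewrite ?eqxx.
Qed.

Definition phi_mx (R : realType) (N : nat) (C : 'cV[R]_('C(N, 2))) : 'M[R]_N :=
  \matrix_(i, j)
    match ltngtP i j with
    | CompareNatLt lt_ij => C (theta (Edge lt_ij)) 0
    | CompareNatGt lt_ji => - C (theta (Edge lt_ji)) 0
    | CompareNatEq _ => 0
    end.

Lemma compare_nat_lt (T : Type) (m n : nat) (f : (m < n)%N -> T)
    (g : (n < m)%N -> T) (h : m = n -> T) (lt_mn : (m < n)%N) :
  match ltngtP m n with
  | CompareNatLt l => f l | CompareNatGt l => g l | CompareNatEq l => h l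
  end = f lt_mn.
Proof.
suff gen a b c d e1 e2 e3 e4 e5 e6
    (l : compare_nat m n a b c d e1 e2 e3 e4 e5 e6) :
  match l with
  | CompareNatLt l => f l | CompareNatGt l => g l | CompareNatEq l => h l
  end = f lt_mn by exact: gen.
case: l => l; first by rewrite (bool_irrelevance l lt_mn).
  by exfalso; move: l lt_mn; lia.
by exfalso; move: l lt_mn; lia.
Qed.

Lemma compare_nat_gt (T : Type) (m n : nat) (f : (m < n)%N -> T)
    (g : (n < m)%N -> T) (h : m = n -> T) (lt_nm : (n < m)%N) :
  match ltngtP m n with
  | CompareNatLt l => f l | CompareNatGt l => g l | CompareNatEq l => h l
  end = g lt_nm.
Proof.
suff gen a b c d e1 e2 e3 e4 e5 e6
    (l : compare_nat m n a b c d e1 e2 e3 e4 e5 e6) :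
  match l with
  | CompareNatLt l => f l | CompareNatGt l => g l | CompareNatEq l => h l
  end = g lt_nm by exact: gen.
case: l => l; last by exfalso; move: l lt_nm; lia.
  by exfalso; move: l lt_nm; lia.
by rewrite (bool_irrelevance l lt_nm).
Qed.

Lemma phi_mx_lt (R : realType) (N : nat) (C : 'cV[R]_('C(N, 2)))
    (i j : 'I_N) (lt_ij : (i < j)%N) :
  phi_mx C i j = C (theta (Edge lt_ij)) 0.
Proof. by rewrite mxE compare_nat_lt. Qed.

Lemma phi_mx_gt (R : realType) (N : nat) (C : 'cV[R]_('C(N, 2)))
    (i j : 'I_N) (lt_ji : (j < i)%N) :
  phi_mx C i j = - C (theta (Edge lt_ji)) 0.
Proof. by rewrite mxE compare_nat_gt. Qed.

Lemma phi_mx_diag (R : realType) (N : nat) (C : 'cV[R]_('C(N, 2)))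
    (i : 'I_N) :
  phi_mx C i i = 0.
Proof. by rewrite mxE; case: (ltngtP i i) => // l; exfalso; move: l; lia. Qed.

(* The inverse of a bijective linear map is automatically linear. *)
Definition isomorphic (R : realType) (aT rT : vectType R)
    (U : {vspace aT}) (V : {vspace rT}) : Prop :=
  exists f : {linear subvs_of U -> subvs_of V}, bijective f.

(* Main.v *)
Require Import Defs.
From HB Require Import structures.
From mathcomp Require Import all_boot all_order all_algebra.
From mathcomp Require Import reals.

Import GRing.Theory.
Local Open Scope ring_scope.

(** Expanding over the edges, phi(C) is the sum of the C(theta(e)) (E_{ij} - E_{ji})
    for e = (i, j), so that phi(C) 1 = - Gamma C: the zero row sums of the
    antisymmetric matrix phi(C) are exactly the condition C \in Ker(Gamma).  An
    antisymmetric matrix is determined by its strictly upper triangular entries,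
    which provides the inverse map. *)

Section EdgeMatrices.

Context {R : realType} {N : nat}.

Implicit Types (C : 'cV[R]_('C(N, 2))) (M : 'M[R]_N).

Lemma edge_eqE (e f : edge N) :
  (e == f) = (source e == source f) && (target e == target f).
Proof. by rewrite -val_eqE; case: e f => [[a b] ?] [[c d] ?]. Qed.

Lemma phi_mx_source_target C (e : edge N) :
  phi_mx C (source e) (target e) = C (theta e) 0.
Proof. by case: e => [[i j] lt_ij]; exact: phi_mx_lt. Qed.

Lemma phi_mx_target_source C (e : edge N) :
  phi_mx C (target e) (source e) = - C (theta e) 0.
Proof. by case: e => [[i j] lt_ij]; exact: phi_mx_gt. Qed.

(** Otherwise [source e < target e = source f < target f = source e]. Hence the reversed unit matrix
    of any edge vanishes above the diagonal, and by symmetry the direct one vanishes below it. *)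
Lemma source_target_neq (e f : edge N) :
  (source e == target f) && (target e == source f) = false.
Proof.
apply/negP => /andP[/eqP st /eqP ts]; have := valP e; have := valP f.
rewrite -/(source e) -/(target e) -/(source f) -/(target f) st ts => lt_f.
by rewrite ltnNge ltnW.
Qed.

Lemma source_target_diag (i : 'I_N) (e : edge N) :
  (i == source e) && (i == target e) = false.
Proof.
apply/negP => /andP[/eqP-> /eqP st]; have := valP e.
by rewrite -/(source e) -/(target e) st ltnn.
Qed.

(** This form, free of case distinctions on the order of the indices, lets linearity, antisymmetry
    and row sums be checked edge by edge. *)
Lemma phi_mx_sum C :
  phi_mx C = \sum_(e : edge N) C (theta e) 0 *:
    (delta_mx (source e) (target e) - delta_mx (target e) (source e)).
Proof.
apply/matrixP => i j; rewrite summxE.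
under eq_bigr => e _ do rewrite !mxE.
case: (ltngtP i j) => [lt_ij|lt_ji|/val_inj->].
- have [e [-> ->]] : exists e : edge N, i = source e /\ j = target e.
    by exists (Edge lt_ij).
  rewrite phi_mx_source_target (bigD1 e) //= big1 => [|f /negPf ne_fe].
    by rewrite source_target_neq !eqxx subr0 mulr1 addr0.
  by rewrite source_target_neq -edge_eqE eq_sym ne_fe subr0 mulr0.
- have [e [-> ->]] : exists e : edge N, j = source e /\ i = target e.
    by exists (Edge lt_ji).
  rewrite phi_mx_target_source (bigD1 e) //= big1 => [|f /negPf ne_fe].
    by rewrite andbC source_target_neq !eqxx sub0r mulrN1 addr0.
  rewrite andbC source_target_neq andbC -edge_eqE eq_sym ne_fe.
  by rewrite subr0 mulr0.
- rewrite phi_mx_diag big1 // => e _.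
  by rewrite [(j == target e) && _]andbC source_target_diag subrr mulr0.
Qed.

Lemma phi_mx_is_linear : linear (@phi_mx R N).
Proof.
move=> a C D; rewrite !phi_mx_sum scaler_sumr -big_split; apply: eq_bigr => e _.
by rewrite !mxE scalerDl scalerA.
Qed.

HB.instance Definition _ := GRing.isLinear.Build R 'cV[R]_('C(N, 2)) 'M[R]_N
  _ (@phi_mx R N) phi_mx_is_linear.

Lemma trmx_phi_mx C : (phi_mx C)^T = - phi_mx C.
Proof.
rewrite phi_mx_sum linear_sum -sumrN; apply: eq_bigr => e _.
by rewrite linearZ linearB /= !trmx_delta -scalerN opprB.
Qed.

(** For an edge from [i] to [j], the matrix $E_{ij} - E_{ji}$ sends the all-ones vector to $e_i -
    e_j$, the opposite of that edge's column of the incidence matrix. *)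
Lemma phi_mx_mul1 C : phi_mx C *m const_mx 1 = - (incidence R N *m C) :> 'cV_N.
Proof.
apply/colP => k; rewrite [RHS]mxE [in RHS]mxE phi_mx_sum mulmx_suml summxE.
(* The product with the incidence matrix runs over edge numbers; [theta] turns it into a sum over
   edges, to be compared termwise. *)
rewrite (reindex (@theta N)) /=; last first.
  by exists (@theta_inv N) => ? _; rewrite ?thetaK ?theta_invK.
rewrite -sumrN; apply: eq_bigr => e _.
have delta_mul1 (a b : 'I_N) :
    (delta_mx a b *m const_mx 1 : 'cV[R]_N) k 0 = (k == a)%:R.
  rewrite mxE (bigD1 b) //= big1 => [|j /negPf ne_jb].
    by rewrite !mxE eqxx andbT mulr1 addr0.
  by rewrite !mxE ne_jb andbF mul0r.
have ne_st : source e != target e by rewrite -val_eqE neq_ltn (valP e : (_ < _)%N).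
rewrite -scalemxAl mulmxBl incidenceE 3!mxE [X in _ * (_ + X)]mxE.
rewrite -[in RHS]mulNr mulrC; congr (_ * _).
have := delta_mul1 (source e) (target e); have := delta_mul1 (target e) (source e).
rewrite !mxE => -> ->.
have [->|_] := eqVneq k (source e); first by rewrite (negPf ne_st) subr0 opprK.
by case: eqP; rewrite ?subr0 ?sub0r ?oppr0.
Qed.

(** The candidate inverse of [phi_mx], defined on all square matrices; it is a right inverse on the
    antisymmetric ones. *)
Definition edge_entries M : 'cV[R]_('C(N, 2)) :=
  \col_r M (source (theta_inv r)) (target (theta_inv r)).

Lemma phi_mxK : cancel (@phi_mx R N) edge_entries.
Proof.
by move=> C; apply/colP => r; rewrite mxE phi_mx_source_target theta_invK.
Qed.

Lemma edge_entriesK M : M^T = - M -> phi_mx (edge_entries M) = M.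
Proof.
move=> skewM; have skew i j : M j i = - M i j.
  by have /matrixP/(_ i j) := skewM; rewrite !mxE.
apply/matrixP => i j; case: (ltngtP i j) => [lt_ij|lt_ji|/val_inj->].
- by rewrite phi_mx_lt mxE thetaK.
- by rewrite phi_mx_gt mxE thetaK skew opprK.
(* A diagonal entry equals its own opposite, so it is zero in an ordered field. *)
- by rewrite phi_mx_diag; apply/esym/eqP; rewrite -Num.Theory.eqNr -skew.
Qed.

Lemma phi_mx_calM C : C \in Ker (incidence R N) -> phi_mx C \in calM R N.
Proof.
move=> /mem_Ker kerC; apply/mem_calM.
by rewrite trmx_phi_mx phi_mx_mul1 kerC oppr0.
Qed.

Lemma edge_entries_Ker M :
  M \in calM R N -> edge_entries M \in Ker (incidence R N).
Proof.
move=> /mem_calM[skewM M1]; apply/mem_Ker/oppr_inj.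
by rewrite -phi_mx_mul1 edge_entriesK // M1 oppr0.
Qed.

End EdgeMatrices.

Theorem mainTheorem1 (R : realType) (N : nat) (hN : (2 <= N)%N) :
  (exists phi : {linear subvs_of (Ker (incidence R N)) ->
                        subvs_of (calM R N)},
      (forall C : subvs_of (Ker (incidence R N)),
         vsval (phi C) = phi_mx (vsval C))
      /\ bijective phi)
  /\ isomorphic (Ker (incidence R N)) (calM R N).
Proof.
(* Composing with the projection [vsproj] gives a linear map into the subspace; by [phi_mx_calM] the
   projection fixes every value taken on the kernel. *)
pose phi : {linear subvs_of (Ker (incidence R N)) -> subvs_of (calM R N)} :=
  vsproj (calM R N) \o (@phi_mx R N \o vsval).
have phiE C : vsval (phi C) = phi_mx (vsval C).
  by rewrite /= vsprojK // phi_mx_calM // subvsP.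
have phi_bij : bijective phi.
  (* Likewise, [edge_entries_Ker] makes the projection onto the kernel harmless here. *)
  exists (vsproj _ \o edge_entries \o vsval) => [C | M]; apply: val_inj.
    by rewrite /= -/(phi C) phiE phi_mxK vsprojK ?subvsP.
  rewrite [LHS]phiE /= vsprojK ?edge_entries_Ker ?subvsP // edge_entriesK //.
  by have /mem_calM[] := subvsP M.
by split; exists phi.
Qed.
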